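(* Let $S$ be a rectangular band semigroup and let $\omega$ be a weight on $S$. Then $\ell^{1}(S,\omega)$ is amenable if and only if $S$ is a singleton.
   Context: A rectangular band semigroup is a semigroup $S$ with $s^2=s$ and $sts=s$ for all $s,t\in S$. A weight on $S$ is a function $\omega:S\to(0,\infty)$ with $\omega(st)\le\omega(s)\omega(t)$. The Beurling algebra $\ell^{1}(S,\omega)$ is the space of $f=\sum_s f(s)\delta_s$ with $\|f\|_\omega=\sum_s|f(s)|\omega(s)<\infty$, with convolution $\delta_s*\delta_t=\delta_{st}$. A Banach algebra $\mathcal{A}$ is amenable if for every Banach $\mathcal{A}$-bimodule $E$, every bounded derivation $\mathcal{A}\to E^*$ is inner. *)

(* Defs.v *)
From HB Require Import structures.
From mathcomp Require Import all_boot all_order all_algebra.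
From mathcomp Require Import all_classical all_reals all_analysis.
From mathcomp Require Import finmap complex.
Import numFieldNormedType.Exports.
Set Implicit Arguments.
Unset Strict Implicit.
Unset Printing Implicit Defensive.
Import Order.TTheory GRing.Theory Num.Theory.
Local Open Scope classical_set_scope.
Local Open Scope ring_scope.

(* Unconditional sums over an arbitrary (choice) index type: the limit *)
(* of the net of finite partial sums, finite sets ordered by inclusion *)
(* (as in mathcomp-analysis' showcase/summability.v).                  *)
Definition totally {I : choiceType} : set_system {fset I} :=
  filter_from setT (fun A => [set B | (A `<=` B)%fset]).

Instance totally_filter {I : choiceType} : ProperFilter (@totally I).
Proof.
eapply filter_from_proper; last by move=> A _; exists A; rewrite /= fsubset_refl.
apply: filter_fromT_filter; first by exists fset0.
by move=> A B /=; exists (A `|` B)%fset => P /=; rewrite fsubUset => /andP[].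
Qed.

Definition partial_sum {I : choiceType} {V : zmodType}
  (x : I -> V) (A : {fset I}) : V := \sum_(i <- A) x i.

Definition usum {I : choiceType} {K : numFieldType} {V : normedModType K}
  (x : I -> V) : V := lim (partial_sum x @ totally).

(* Amenability of a Banach algebra.  The algebra is given by a carrier *)
(* predicate [inA] inside a K-vector space [V], a norm [nA] and a      *)
(* product [mulA].                                                     *)
Section Amenability.
Variables (K : numFieldType) (V : lmodType K) (inA : V -> Prop)
  (nA : V -> K) (mulA : V -> V -> V).

Definition bdd_functional (E : normedModType K) (phi : E -> K) :=
  [/\ forall x y : E, phi (x + y) = phi x + phi y,
      forall (k : K) (x : E), phi (k *: x) = k * phi x &
      exists c : K, forall x : E, `|phi x| <= c * `|x| ].

Definition banach_bimodule (E : completeNormedModType K)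
    (la : V -> E -> E) (ra : E -> V -> E) :=
  [/\
      [/\ forall a b x, inA a -> inA b -> la (a + b) x = la a x + la b x,
          forall (k : K) a x, inA a -> la (k *: a) x = k *: la a x,
          forall a x y, inA a -> la a (x + y) = la a x + la a y &
          forall (k : K) a x, inA a -> la a (k *: x) = k *: la a x],
      [/\ forall a b x, inA a -> inA b -> ra x (a + b) = ra x a + ra x b,
          forall (k : K) a x, inA a -> ra x (k *: a) = k *: ra x a,
          forall a x y, inA a -> ra (x + y) a = ra x a + ra y a &
          forall (k : K) a x, inA a -> ra (k *: x) a = k *: ra x a],
      [/\ forall a b x, inA a -> inA b -> la (mulA a b) x = la a (la b x),
          forall a b x, inA a -> inA b -> ra x (mulA a b) = ra (ra x a) b &
          forall a b x, inA a -> inA b -> ra (la a x) b = la a (ra x b)] &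
      exists c : K, forall a x, inA a ->
         `|la a x| <= c * nA a * `|x| /\ `|ra x a| <= c * nA a * `|x| ].

(* D : A -> E^*, encoded as D a x = <x, D a>, is a bounded derivation,
   where E^* carries the dual module actions
   <x, a . phi> = <x . a, phi>  and  <x, phi . a> = <a . x, phi>. *)
Definition bdd_derivation (E : completeNormedModType K)
    (la : V -> E -> E) (ra : E -> V -> E) (D : V -> E -> K) :=
  [/\ forall a, inA a -> bdd_functional (D a),
      forall a b x, inA a -> inA b -> D (a + b) x = D a x + D b x,
      forall (k : K) a x, inA a -> D (k *: a) x = k * D a x,
      exists c : K, forall a x, inA a -> `|D a x| <= c * nA a * `|x| &
      forall a b x, inA a -> inA b ->
        D (mulA a b) x = D b (ra x a) + D a (la b x) ].

(* D is inner: D = ad_phi, ad_phi a = a . phi - phi . a, phi in E^* *)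
Definition inner_derivation (E : completeNormedModType K)
    (la : V -> E -> E) (ra : E -> V -> E) (D : V -> E -> K) :=
  exists phi : E -> K, bdd_functional phi /\
    forall a x, inA a -> D a x = phi (ra x a) - phi (la a x).

Definition amenable :=
  forall (E : completeNormedModType K) (la : V -> E -> E) (ra : E -> V -> E),
    banach_bimodule la ra ->
    forall D : V -> E -> K, bdd_derivation la ra D -> inner_derivation la ra D.

End Amenability.

Definition rectangular_band (S : Type) (op : S -> S -> S) :=
  [/\ associative op, forall s, op s s = s & forall s t, op (op s t) s = s].

Definition is_weight (R : realType) (S : Type) (op : S -> S -> S)
    (w : S -> R) :=
  (forall s, 0 < w s) /\ (forall s t, w (op s t) <= w s * w t).

Section Beurling.
Variables (R : realType) (S : choiceType) (op : S -> S -> S) (w : S -> R).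
Local Notation C := (R[i] : numFieldType).

Definition wC (s : S) : C := real_complex R (w s).

Definition in_l1 (f : S -> C) : Prop :=
  exists M : C, forall J : {fset S}, \sum_(s <- J) `|f s| * wC s <= M.

Definition l1norm (f : S -> C) : C := usum (fun s => `|f s| * wC s).

(* convolution: (f * g)(u) = sum_{st = u} f(s) g(t),
   i.e. the product determined by delta_s * delta_t = delta_{st} *)
Definition conv (f g : S -> C) : S -> C :=
  fun u => usum (fun p : S * S => if op p.1 p.2 == u then f p.1 * g p.2 else 0).

Definition beurling_amenable : Prop :=
  @amenable C (S -> C) in_l1 l1norm conv.

End Beurling.

(* Main.v *)
(** For a weight [w] on a semigroup [S], a function [g] on [S] with
    [|g| <= c w] defines the bounded functional [a |-> sum_s a(s) g(s)] on
    [l1(S, w)], multiplicative when [g] is.  Given two characters [phi], [psi]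
    of an amenable algebra, let it act on the complex line from the left by
    [psi] and from the right by [phi]: the derivations into the dual of this
    bimodule are the point derivations at [(phi, psi)], and the inner ones are
    the multiples of [phi - psi].

    A weight on a semigroup of idempotents is at least [1], so indicator
    functions are admissible.  If [f(st) = f(s)], the indicator of a level set
    of [f] is a point derivation at the zero character and the augmentation;
    amenability makes it constant, hence [f] is constant, and similarly if
    [f(st) = f(t)].  In a rectangular band [stu = su], so this applies to
    [s |-> sp] and to [s |-> ps]: thus [qp = p = pq] and [q = qpq = p].

    Conversely, [l1] of a point is spanned by an idempotent [e], and a
    derivation [D] is inner, implemented by [e . D(e) - D(e) . e]. *)
Require Import Defs.
From HB Require Import structures.
From mathcomp Require Import all_boot all_order all_algebra.
From mathcomp Require Import all_classical all_reals all_analysis.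
From mathcomp Require Import finmap complex.
Import Order.TTheory GRing.Theory Num.Theory numFieldNormedType.Exports.
Set Implicit Arguments.
Unset Strict Implicit.
Unset Printing Implicit Defensive.
Local Open Scope classical_set_scope.
Local Open Scope ring_scope.

Lemma ler_norm_dominated (K : numDomainType) (V W : normedZmodType K) (k : K)
    (x : V) (y : W) : `|x| <= k * `|y| -> `|x| <= `|k| * `|y|.
Proof.
move=> xy; have ky0 := le_trans (normr_ge0 x) xy.
by rewrite (le_trans xy) // -(ger0_norm ky0) normrM normr_id.
Qed.

Lemma ler_normM_dominated (K : numDomainType) (a b c m : K) :
  `|b| <= c * m -> `|a * b| <= c * (`|a| * m).
Proof. by move=> bm; rewrite normrM mulrCA ler_wpM2l. Qed.

Section FiniteSums.
Variable I : choiceType.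
Implicit Types A B : {fset I}.

Lemma sum_fsetD (V : nmodType) (x : I -> V) A B : (A `<=` B)%fset ->
  \sum_(i <- B) x i = \sum_(i <- A) x i + \sum_(i <- (B `\` A)%fset) x i.
Proof.
move=> AB; rewrite (big_fsetID _ (mem A)) /=; congr (_ + _).
  apply: eq_fbigl => i; rewrite !inE andbC /= andb_idr //.
  exact: (fsubsetP AB).
by apply: eq_fbigl => i; rewrite !inE andbC.
Qed.

Lemma ler_sum_fsubset (K : numDomainType) (x : I -> K) A B :
  (A `<=` B)%fset -> (forall i, 0 <= x i) ->
  \sum_(i <- A) x i <= \sum_(i <- B) x i.
Proof. by move=> AB x0; rewrite (sum_fsetD x AB) lerDl sumr_ge0. Qed.

Lemma bounded_sum_tail (R : realType) (x : I -> R) (M : R) :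
  (forall A, \sum_(i <- A) x i <= M) -> forall e, 0 < e ->
  exists A, forall B, (forall i, i \in B -> i \notin A) ->
    \sum_(i <- B) x i <= e.
Proof.
move=> xM e e0; pose sums := [set \sum_(i <- A) x i | A in [set: {fset I}]].
have sums_sup : has_sup sums.
  split; first by exists (\sum_(i <- fset0) x i), fset0.
  by exists M => _ [A _ <-].
have [_ [A _ <-] supA] := sup_adherent e0 sums_sup.
exists A => B BA; rewrite -(lerD2l (\sum_(i <- A) x i)).
have -> : \sum_(i <- A) x i + \sum_(i <- B) x i =
    \sum_(i <- (A `|` B)%fset) x i.
  rewrite (sum_fsetD x (fsubsetUl A B)); congr (_ + _).
  apply: eq_fbigl => i; rewrite !inE.
  by have [/BA ->|_] := boolP (i \in B); rewrite ?orbT // orbF andNb.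
apply: (@le_trans _ _ (sup sums)); last by rewrite -lerBlDr ltW.
by apply: ub_le_sup; [case: sums_sup|exists (A `|` B)%fset].
Qed.

End FiniteSums.

Lemma cvg_ge0 (K : numFieldType) (T : Type) (F : set_system T) (f : T -> K)
    (l : K) : ProperFilter F ->
  (forall t, 0 <= f t) -> f @ F --> l -> 0 <= l.
Proof.
(* The order of [K] need not be total: nonnegativity is read off [`|l| = l]. *)
move=> FF f0 fl; have -> : l = `|l|; last exact: normr_ge0.
apply: (cvg_unique (@norm_hausdorff K K) fl).
have -> : f = (fun t => `|f t|) by apply/funext => t; rewrite ger0_norm.
exact: cvg_norm.
Qed.

Section UnconditionalSums.
Variables (I : choiceType) (K : numFieldType).

Section NormedModule.
Variable V : normedModType K.
Implicit Types (x y : I -> V) (l : V).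

Lemma cvg_partial_sumP x l : partial_sum x @ totally --> l <->
  forall e : K, 0 < e -> exists A, forall B, (A `<=` B)%fset ->
    `|l - \sum_(i <- B) x i| <= e.
Proof.
split=> [/cvgrPdist_le xl e /xl[A _ A_le]|xl]; first by exists A.
by apply/cvgrPdist_le => e /xl[A A_le]; exists A.
Qed.

Lemma usum_unique x l : partial_sum x @ totally --> l -> usum x = l.
Proof. by move=> xl; apply: cvg_lim => //; exact: norm_hausdorff. Qed.

Lemma usum_single x i0 : (forall i, i != i0 -> x i = 0) -> usum x = x i0.
Proof.
move=> x0; apply: usum_unique; apply/cvg_partial_sumP => e e0.
exists [fset i0]%fset => B; rewrite fsub1set => i0B.
rewrite (big_fsetD1 i0) //= big_seq big1 ?addr0 ?subrr ?normr0 ?ltW //.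
by move=> i; rewrite !inE => /andP[/x0].
Qed.

Lemma usumD x y : cvg (partial_sum x @ totally) ->
  cvg (partial_sum y @ totally) ->
  usum (fun i => x i + y i) = usum x + usum y.
Proof.
move=> cx cy; apply: usum_unique.
have -> : partial_sum (fun i => x i + y i) = partial_sum x + partial_sum y.
  by apply/funext => J; rewrite /partial_sum big_split.
exact: cvgD.
Qed.

Lemma usum_norm_le x (M : K) : cvg (partial_sum x @ totally) ->
  (forall A : {fset I}, `|\sum_(i <- A) x i| <= M) -> `|usum x| <= M.
Proof.
move=> cx xM; rewrite -subr_ge0.
apply: cvg_ge0 (cvgB (cvg_cst M) (cvg_norm cx)) => A.
by rewrite subr_ge0; exact: xM.
Qed.

Lemma usum_norm_le_usum x (y : I -> K) : cvg (partial_sum x @ totally) ->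
  cvg (partial_sum y @ totally) -> (forall i, `|x i| <= y i) ->
  `|usum x| <= usum y.
Proof.
move=> cx cy xy; rewrite -subr_ge0.
apply: cvg_ge0 (cvgB cy (cvg_norm cx)) => A.
rewrite subr_ge0 (le_trans (ler_norm_sum _ _ _)) //.
by apply: ler_sum => i _; exact: xy.
Qed.

End NormedModule.

Lemma eq_usum (x y : I -> K) : x =1 y -> usum x = usum y.
Proof. by move=> /funext ->. Qed.

Lemma mulr_usumr (k : K) (x : I -> K) : cvg (partial_sum x @ totally) ->
  k * usum x = usum (fun i => k * x i).
Proof.
move=> cx; apply/esym/usum_unique.
have -> : partial_sum (fun i => k * x i) = (fun J => k * partial_sum x J).
  by apply/funext => J; rewrite /partial_sum mulr_sumr.
exact: cvgM (cvg_cst k) cx.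
Qed.

End UnconditionalSums.

Section ComplexComplete.
Variable R : realType.
Local Notation C := (R[i] : numFieldType).

Lemma normc_ge_Im (z : R[i]) : (`|complex.Im z|%:C)%C <= `|z|.
Proof.
by rewrite normc_def lecR -sqrtr_sqr ler_wsqrtr // lerDr sqr_ge0.
Qed.

Lemma normc_le_Re_Im (z : R[i]) :
  `|z| <= ((`|complex.Re z| + `|complex.Im z|)%:C)%C.
Proof.
rewrite normc_def lecR -[leRHS]ger0_norm ?addr_ge0 // -sqrtr_sqr.
rewrite ler_wsqrtr // sqrrD !real_normK ?num_real //.
by rewrite lerD2r lerDl mulrn_wge0 ?mulr_ge0.
Qed.

Lemma cvg_comp_nonexpansive (h : R[i] -> R) (F : set_system C^o) :
  (forall x y, (`|h x - h y|%:C)%C <= `|x - y|) ->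
  ProperFilter F -> cauchy F -> cvg (h @ F).
Proof.
move=> h_lip FF /cauchyP Fc; apply: R_complete; apply/cauchyP => e e0.
have e0C : 0 < (e%:C)%C :> C by rewrite ltcR.
have [x Fx] := Fc _ e0C; exists (h x).
rewrite /fmap /nbhs /=; apply: filterS Fx => y; rewrite /ball /= => xy.
by rewrite -ltcR (le_lt_trans (h_lip x y) xy).
Qed.

Lemma complex_complete (F : set_system C^o) :
  ProperFilter F -> cauchy F -> cvg F.
Proof.
move=> FF Fc.
have cRe : cvg (@complex.Re R @ F).
  apply: cvg_comp_nonexpansive => // x y.
  by rewrite -raddfB; exact: normc_ge_Re.
have cIm : cvg (@complex.Im R @ F).
  apply: cvg_comp_nonexpansive => // x y.
  by rewrite -raddfB; exact: normc_ge_Im.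
apply/cvg_ex.
exists (Complex (lim (@complex.Re R @ F)) (lim (@complex.Im R @ F))).
apply/cvgrPdist_le => /= e; rewrite ltcE /= => /andP[/eqP Ime e0].
have e2 : 0 < complex.Re e / 2 by rewrite divr_gt0.
near=> z.
apply: (le_trans (normc_le_Re_Im _)).
rewrite lecE /= Ime eqxx /= !raddfB /= [leRHS]splitr lerD //.
  by near: z; move/cvgrPdist_le: cRe; apply.
by near: z; move/cvgrPdist_le: cIm; apply.
Unshelve. all: by end_near. Qed.

(* An alias is needed: the [Complete] instance on [R^o] is already keyed to
   [realType], so completeness of [C^o] would not be found by inference. *)
Definition complex_line : Type := C^o.
HB.instance Definition _ := NormedModule.copy complex_line C^o.
HB.instance Definition _ :=
  Uniform_isComplete.Build complex_line complex_complete.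

End ComplexComplete.

Section AbsolutelySummable.
Variable R : realType.
Local Notation C := (R[i] : numFieldType).

Definition abs_summable (I : choiceType) (x : I -> C) : Prop :=
  exists M : C, forall A : {fset I}, \sum_(i <- A) `|x i| <= M.

Section OneIndex.
Variable I : choiceType.
Implicit Types (x y : I -> C) (A B : {fset I}).

Lemma abs_summable_dominated (k : C) x y :
  (forall i, `|x i| <= k * `|y i|) -> abs_summable y -> abs_summable x.
Proof.
move=> xy [M yM]; exists (`|k| * M) => A.
apply: le_trans (ler_wpM2l (normr_ge0 k) (yM A)).
by rewrite mulr_sumr; apply: ler_sum => i _; exact: ler_norm_dominated (xy i).
Qed.

Lemma abs_summable_tail x : abs_summable x -> forall e : C, 0 < e ->
  exists A, forall B, (forall i, i \in B -> i \notin A) ->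
    \sum_(i <- B) `|x i| <= e.
Proof.
move=> [M xM] e; rewrite ltcE => /andP[/eqP /= Ime e0].
have sum_normE A : \sum_(i <- A) `|x i| =
    (\sum_(i <- A) complex.Re `|x i|)%:C%C.
  rewrite rmorph_sum; apply: eq_bigr => i _.
  by apply/esym/RRe_real; exact: normr_real.
have Re_sum_le A : \sum_(i <- A) complex.Re `|x i| <= complex.Re M.
  by have := xM A; rewrite sum_normE lecE => /andP[].
have [A tailA] := bounded_sum_tail Re_sum_le e0.
by exists A => B /tailA; rewrite sum_normE lecE /= Ime eqxx.
Qed.

Lemma abs_summable_cvg x : abs_summable x -> cvg (partial_sum x @ totally).
Proof.
move=> sx; suff : cvg (partial_sum x @ totally : set_system (complex_line R)).
  by [].
apply: cauchy_cvg; apply/cauchyP => e e0.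
have e2 : 0 < e / 2 by rewrite divr_gt0.
have [A tailA] := abs_summable_tail sx e2.
exists (\sum_(i <- A) x i : C); exists A => // B AB.
rewrite /ball /= /partial_sum (sum_fsetD x AB) opprD addNKr normrN.
apply: (@le_lt_trans _ _ (e / 2)); last first.
  by rewrite ltr_pdivrMr // ltr_pMr // ltr1n.
rewrite (le_trans (ler_norm_sum _ _ _)) // tailA //.
by move=> i; rewrite !inE => /andP[].
Qed.

Lemma abs_summable_if (P : pred I) x :
  abs_summable x -> abs_summable (fun i => if P i then x i else 0).
Proof.
move=> sx; apply: (abs_summable_dominated (k := 1)) sx => i.
by rewrite mul1r; case: ifP; rewrite ?normr0.
Qed.

Lemma usumID (P : pred I) x : abs_summable x ->
  usum x = usum (fun i => if P i then x i else 0) +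
           usum (fun i => if ~~ P i then x i else 0).
Proof.
move=> sx; rewrite -usumD; [|exact/abs_summable_cvg/abs_summable_if..].
by apply: eq_usum => i; case: (P i); rewrite ?addr0 ?add0r.
Qed.

Lemma usum_tail x : abs_summable x -> forall e : C, 0 < e ->
  exists A, forall P : pred I, (forall i, P i -> i \notin A) ->
    `|usum (fun i => if P i then x i else 0)| <= e.
Proof.
move=> sx e /(abs_summable_tail sx)[A tailA]; exists A => P PA.
apply: usum_norm_le (abs_summable_cvg (abs_summable_if P sx)) _ => B.
rewrite -big_mkcond big_fset_condE (le_trans (ler_norm_sum _ _ _)) // tailA //.
by move=> i; rewrite !inE => /andP[_ /PA].
Qed.

End OneIndex.

Section Fibres.
Variables (I J : choiceType) (f : I -> J) (x : I -> C).
Hypothesis sx : abs_summable x.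

Lemma sum_usum_fibres (B : {fset J}) :
  \sum_(j <- B) usum (fun i => if f i == j then x i else 0) =
  usum (fun i => if f i \in B then x i else 0).
Proof.
elim/fset1U_rect: B => [|j B jB IH].
  rewrite big_seq_fset0 (@usum_unique _ _ _ _ 0) //.
  by apply/cvg_partial_sumP => e e0; exists fset0 => A _;
    rewrite big1 // subrr normr0 ltW.
rewrite big_fsetU1 //= IH -usumD; [|exact/abs_summable_cvg/abs_summable_if..].
apply: eq_usum => i; rewrite !inE.
by case: eqP => [->|] /=; rewrite ?(negPf jB) ?addr0 ?add0r.
Qed.

Lemma usum_fibres :
  usum (fun j => usum (fun i => if f i == j then x i else 0)) = usum x.
Proof.
apply: usum_unique; apply/cvg_partial_sumP => e e0.
have [A tailA] := usum_tail sx e0.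
exists [fset f i | i in A]%fset => B AB.
rewrite sum_usum_fibres (usumID (fun i => f i \in B) sx) addrC addKr.
apply: tailA => i; apply: contra => iA.
by apply: (fsubsetP AB); exact: in_imfset.
Qed.

End Fibres.

Section Products.
Variables (I J : choiceType) (x : I -> C) (y : J -> C).
Hypotheses (sx : abs_summable x) (sy : abs_summable y).

Lemma abs_summable_prod : abs_summable (fun p : I * J => x p.1 * y p.2).
Proof.
have [[M xM] [N yN]] := (sx, sy); exists (M * N) => F.
pose A := [fset p.1 | p in F]%fset; pose B := [fset p.2 | p in F]%fset.
have FAB : (F `<=` [fset ((i, j) : I * J) | i in A, j in B])%fset.
  apply/fsubsetP => -[i j] ijF; apply/imfset2P; exists i.
    by apply/imfsetP; exists (i, j).
  by exists j => //; apply/imfsetP; exists (i, j).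
apply: le_trans (ler_sum_fsubset FAB _) _ => [p|]; first exact: normr_ge0.
rewrite big_imfset2 /=; last by move=> [i j] [i' j'] _ _ /= [-> ->].
under eq_bigr do under eq_bigr do rewrite normrM.
under eq_bigr do rewrite -mulr_sumr.
by rewrite -mulr_suml ler_pM ?sumr_ge0.
Qed.

Lemma usum_prod : usum (fun p : I * J => x p.1 * y p.2) = usum x * usum y.
Proof.
have sxy := abs_summable_prod.
rewrite -(usum_fibres fst sxy) mulrC (mulr_usumr _ (abs_summable_cvg sx)).
apply: eq_usum => i; rewrite mulrC (mulr_usumr _ (abs_summable_cvg sy)).
rewrite -(usum_fibres snd (abs_summable_if (fun p => p.1 == i) sxy)).
apply: eq_usum => j; rewrite (@usum_single _ _ _ _ (i, j)) /= ?eqxx //.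
move=> [i' j'] /= neq; case: eqP => // jj'; case: eqP => // ii'.
by rewrite ii' jj' eqxx in neq.
Qed.

End Products.
End AbsolutelySummable.

Section BoundedFunctionals.
Variables (K : numFieldType) (E : normedModType K).
Implicit Types phi psi : E -> K.

Lemma bdd_functionalB phi psi : bdd_functional phi -> bdd_functional psi ->
  bdd_functional (fun x => phi x - psi x).
Proof.
move=> [phiD phiZ [b phi_le]] [psiD psiZ [c psi_le]]; split=> [x y|k x|].
- by rewrite phiD psiD opprD addrACA.
- by rewrite phiZ psiZ mulrBr.
by exists (b + c) => x; rewrite (le_trans (ler_normB _ _)) // mulrDl lerD.
Qed.

Lemma bdd_functional_comp phi (f : E -> E) (c : K) : bdd_functional phi ->
  (forall x y, f (x + y) = f x + f y) ->
  (forall (k : K) x, f (k *: x) = k *: f x) ->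
  (forall x, `|f x| <= c * `|x|) -> bdd_functional (phi \o f).
Proof.
move=> [phiD phiZ [b phi_le]] fD fZ f_le; split=> [x y|k x|] /=.
- by rewrite fD phiD.
- by rewrite fZ phiZ.
exists (`|b| * c) => x; rewrite -mulrA.
by rewrite (le_trans (ler_norm_dominated (phi_le _))) // ler_wpM2l.
Qed.

End BoundedFunctionals.

Section AmenableLine.
Variables (K : numFieldType) (V : lmodType K) (inA : V -> Prop) (nA : V -> K)
  (mulA : V -> V -> V) (e : V).
Hypotheses (eA : inA e) (ee : mulA e e = e).

Section Derivation.
Variables (E : completeNormedModType K) (la : V -> E -> E) (ra : E -> V -> E).
Variable D : V -> E -> K.
Hypotheses (bim : banach_bimodule inA nA mulA la ra)
  (der : bdd_derivation inA nA mulA la ra D).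

Lemma derivation_idempotent x : D e x = D e (ra x e) + D e (la e x).
Proof. by have [_ _ _ _ DM] := der; rewrite -DM // ee. Qed.

(* The derivation rule at [e x e] reads [D e (e x e) = 2 D e (e x e)]. *)
Lemma derivation_idempotent_corner x : D e (la e (ra x e)) = 0.
Proof.
have [_ _ [laM raM lra] _] := bim.
have := derivation_idempotent (la e (ra x e)).
rewrite lra // -laM // -raM // ee => /eqP.
by rewrite -subr_eq0 opprD addNKr oppr_eq0 => /eqP.
Qed.

Definition implementing_functional (x : E) : K := D e (ra x e) - D e (la e x).

Lemma bdd_functional_implementing : bdd_functional implementing_functional.
Proof.
have [[_ _ laD laZ] [_ _ raD raZ] _ [c act_le]] := bim.
have [/(_ e eA) De _ _ _ _] := der.
apply: bdd_functionalB.
  apply: (bdd_functional_comp (c := c * nA e) De) => [x y|k x|x].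
  - exact: raD.
  - exact: raZ.
  - by have [] := act_le e x eA.
apply: (bdd_functional_comp (c := c * nA e) De) => [x y|k x|x].
- exact: laD.
- exact: laZ.
- by have [] := act_le e x eA.
Qed.

End Derivation.

Lemma amenable_idempotent_line :
  (forall a, inA a -> exists k, a = k *: e) -> amenable inA nA mulA.
Proof.
move=> lineA E la ra bim D der.
exists (implementing_functional la ra D).
split=> [|a x /lineA[k ->]]; first exact: bdd_functional_implementing bim der.
have [[_ laZl _ laZ] [_ raZl _ raZ] [laM raM lra] _] := bim.
have [De _ DZ _ _] := der; have [_ DeZ _] := De e eA.
have corner0 := derivation_idempotent_corner bim der.
rewrite /implementing_functional DZ // raZl // laZl //.
rewrite raZ // laZ // raZ // laZ // !DeZ.
rewrite -raM // -laM // lra // ee corner0 (derivation_idempotent der x).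
by rewrite !mulr0 subr0 sub0r opprK mulrDr.
Qed.

End AmenableLine.

Section PointDerivations.
Variables (K : numFieldType) (V : lmodType K) (inA : V -> Prop) (nA : V -> K)
  (mulA : V -> V -> V).

Definition bdd_form (phi : V -> K) : Prop :=
  [/\ forall a b, inA a -> inA b -> phi (a + b) = phi a + phi b,
      forall (k : K) a, inA a -> phi (k *: a) = k * phi a &
      exists c : K, forall a, inA a -> `|phi a| <= c * nA a].

(* The zero functional is allowed as a character. *)
Definition bdd_character (phi : V -> K) : Prop :=
  bdd_form phi /\
  forall a b, inA a -> inA b -> phi (mulA a b) = phi a * phi b.

Definition point_derivation (phi psi d : V -> K) : Prop :=
  bdd_form d /\ forall a b, inA a -> inA b ->
    d (mulA a b) = phi a * d b + d a * psi b.

End PointDerivations.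

Section PointBimodule.
Variables (R : realType) (V : lmodType R[i]).
Local Notation C := (R[i] : numFieldType).
Local Notation L := (complex_line R).

Definition left_scaling (psi : V -> C) (a : V) (x : L) : L := psi a *: x.
Definition right_scaling (phi : V -> C) (x : L) (a : V) : L := phi a *: x.

Variables (inA : V -> Prop) (nA : V -> C) (mulA : V -> V -> V).
Variables phi psi : V -> C.
Hypotheses (phi_char : bdd_character inA nA mulA phi)
  (psi_char : bdd_character inA nA mulA psi).

Lemma banach_bimodule_point :
  banach_bimodule inA nA mulA (left_scaling psi) (right_scaling phi).
Proof.
have [[[phiD phiZ [b phi_le]] phiM] [[psiD psiZ [c psi_le]] psiM]] :=
  (phi_char, psi_char).
split; [split=> [a a' x aA a'A|k a x aA|a x y aA|k a x aA]..| |].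
- by rewrite /left_scaling psiD // scalerDl.
- by rewrite /left_scaling psiZ // scalerA.
- by rewrite /left_scaling scalerDr.
- by rewrite /left_scaling !scalerA mulrC.
- by rewrite /right_scaling phiD // scalerDl.
- by rewrite /right_scaling phiZ // scalerA.
- by rewrite /right_scaling scalerDr.
- by rewrite /right_scaling !scalerA mulrC.
- split=> a a' x aA a'A.
  + by rewrite /left_scaling psiM // scalerA.
  + by rewrite /right_scaling phiM // scalerA mulrC.
  + by rewrite /left_scaling /right_scaling !scalerA mulrC.
exists (c + b) => a x aA; rewrite /left_scaling /right_scaling !normrZ.
have c0 := le_trans (normr_ge0 _) (psi_le a aA).
have b0 := le_trans (normr_ge0 _) (phi_le a aA).
split; rewrite ler_wpM2r // mulrDl.
  by rewrite (le_trans (psi_le a aA)) // lerDl.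
by rewrite (le_trans (phi_le a aA)) // lerDr.
Qed.

Lemma bdd_derivation_point (d : V -> C) :
  point_derivation inA nA mulA phi psi d ->
  bdd_derivation inA nA mulA (left_scaling psi) (right_scaling phi)
    (fun a x => d a * (x : C)).
Proof.
move=> [[dD dZ [c d_le]] dM]; split=> [a aA|a b x aA bA|k a x aA||a b x aA bA].
- split=> [x y|k x|]; first exact: mulrDr.
    exact: mulrCA.
  by exists `|d a| => x; rewrite normrM.
- by rewrite dD // mulrDl.
- by rewrite dZ // mulrA.
- by exists c => a x aA; rewrite normrM ler_wpM2r // d_le.
by rewrite dM // mulrDl /right_scaling /left_scaling (mulrC (phi a)) -!mulrA.
Qed.

Lemma amenable_point_derivation (d : V -> C) : amenable inA nA mulA ->
  point_derivation inA nA mulA phi psi d ->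
  exists c : C, forall a, inA a -> d a = c * (phi a - psi a).
Proof.
move=> amenA /bdd_derivation_point der.
have [f [[_ fZ _] fE]] := amenA _ _ _ banach_bimodule_point _ der.
exists (f (1 : C)) => a /(fE _ (1 : C)).
by rewrite mulr1 /right_scaling /left_scaling !fZ -mulrBl mulrC.
Qed.

End PointBimodule.

Section WeightedL1.
Variables (R : realType) (S : choiceType) (w : S -> R).
Local Notation C := (R[i] : numFieldType).
Hypothesis w_gt0 : forall s, 0 < w s.

Lemma wC_gt0 s : 0 < wC w s.
Proof. by rewrite /wC ltcR. Qed.

Lemma normM_wC (z : C) s : `|z * wC w s| = `|z| * wC w s.
Proof. by rewrite normrM (gtr0_norm (wC_gt0 s)). Qed.

Lemma in_l1P (a : S -> C) :
  in_l1 w a <-> abs_summable (fun s => a s * wC w s).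
Proof.
have sumE A : \sum_(s <- A) `|a s * wC w s| = \sum_(s <- A) `|a s| * wC w s.
  by apply: eq_bigr => s _; rewrite normM_wC.
by split=> -[M aM]; exists M => A; [rewrite sumE|rewrite -sumE]; exact: aM.
Qed.

Lemma in_l1_single (a : S -> C) s0 :
  (forall s, s != s0 -> a s = 0) -> in_l1 w a.
Proof.
move=> a0; exists (`|a s0| * wC w s0) => A.
have aw_ge0 s : 0 <= `|a s| * wC w s by rewrite mulr_ge0 // ltW // wC_gt0.
apply: le_trans (ler_sum_fsubset (fsubsetU1 s0 A) aw_ge0) _.
rewrite (big_fsetD1 s0) ?fset1U1 //= big_seq big1 ?addr0 // => s.
by rewrite !inE => /andP[/a0 -> _]; rewrite normr0 mul0r.
Qed.

(* The dual of [l1(S, w)] consists of the functions that are bounded relative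
   to [w]. *)
Definition weight_bounded (g : S -> C) : Prop :=
  exists c : C, forall s, `|g s| <= c * wC w s.

Lemma weight_bounded_delta t : weight_bounded (fun s => (s == t)%:R).
Proof.
exists (wC w t)^-1 => s; have [->|_] := eqVneq s t.
  by rewrite normr1 mulVf // gt_eqF // wC_gt0.
by rewrite normr0 mulr_ge0 // ?invr_ge0 ltW // wC_gt0.
Qed.

Definition pairing (g a : S -> C) : C := usum (fun s => a s * g s).

Lemma pairing_delta (g : S -> C) s : pairing g (fun t => (t == s)%:R) = g s.
Proof.
rewrite /pairing (@usum_single _ _ _ _ s) ?eqxx ?mul1r // => t /negPf ->.
by rewrite mul0r.
Qed.

Lemma abs_summable_pairing (g a : S -> C) : weight_bounded g ->
  in_l1 w a -> abs_summable (fun s => a s * g s).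
Proof.
move=> [c g_le] /in_l1P; apply: (abs_summable_dominated (k := c)) => s.
by rewrite normM_wC; exact: ler_normM_dominated (g_le s).
Qed.

Lemma pairing_le (g a : S -> C) (c : C) : (forall s, `|g s| <= c * wC w s) ->
  in_l1 w a -> `|pairing g a| <= c * l1norm w a.
Proof.
move=> g_le al1; have gw : weight_bounded g by exists c.
have sum_norm_a : abs_summable (fun s => `|a s| * wC w s).
  move/in_l1P: al1; apply: (abs_summable_dominated (k := 1)) => s.
  by rewrite !normM_wC normr_id mul1r.
rewrite /l1norm mulr_usumr; last exact: abs_summable_cvg.
apply: usum_norm_le_usum => [||s]; last exact: ler_normM_dominated (g_le s).
- exact/abs_summable_cvg/abs_summable_pairing.
apply: abs_summable_cvg.
by apply: (abs_summable_dominated (k := `|c|)) sum_norm_a => s; rewrite normrM.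
Qed.

Lemma bdd_form_pairing (g : S -> C) :
  weight_bounded g -> bdd_form (in_l1 w) (l1norm w) (pairing g).
Proof.
move=> gw; split=> [a b al1 bl1|k a al1|].
- rewrite /pairing -usumD; [|exact/abs_summable_cvg/abs_summable_pairing..].
  by apply: eq_usum => s; rewrite -mulrDl.
- rewrite /pairing mulr_usumr; last exact/abs_summable_cvg/abs_summable_pairing.
  by apply: eq_usum => s; rewrite mulrA.
by have [c g_le] := gw; exists c => a; exact: pairing_le.
Qed.

Lemma abs_summable_prod_pairing (g h a b : S -> C) : weight_bounded g ->
  weight_bounded h -> in_l1 w a -> in_l1 w b ->
  abs_summable (fun p : S * S => a p.1 * b p.2 * (g p.1 * h p.2)).
Proof.
move=> gw hw al1 bl1.
have := abs_summable_prod
  (abs_summable_pairing gw al1) (abs_summable_pairing hw bl1).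
by apply: (abs_summable_dominated (k := 1)) => p; rewrite mul1r mulrACA.
Qed.

Lemma usum_prod_pairing (g h a b : S -> C) : weight_bounded g ->
  weight_bounded h -> in_l1 w a -> in_l1 w b ->
  usum (fun p : S * S => a p.1 * b p.2 * (g p.1 * h p.2)) =
  pairing g a * pairing h b.
Proof.
move=> gw hw al1 bl1; rewrite -usum_prod; [|exact: abs_summable_pairing..].
by apply: eq_usum => p; rewrite mulrACA.
Qed.

End WeightedL1.

Section BeurlingAlgebra.
Variables (R : realType) (S : choiceType) (op : S -> S -> S) (w : S -> R).
Local Notation C := (R[i] : numFieldType).
Hypothesis ww : is_weight op w.

Lemma wC_op s t : wC w (op s t) <= wC w s * wC w t.
Proof. by rewrite /wC -rmorphM lecR ww.2. Qed.

Section Convolution.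
Variables a b : S -> C.
Hypotheses (al1 : in_l1 w a) (bl1 : in_l1 w b).

Lemma abs_summable_pairing_op (g : S -> C) : weight_bounded w g ->
  abs_summable (fun p : S * S => a p.1 * b p.2 * g (op p.1 p.2)).
Proof.
move=> [c g_le].
have g_op_le s t : `|g (op s t)| <= c * (wC w s * wC w t).
  have := le_trans (normr_ge0 _) (g_le s).
  rewrite (pmulr_lge0 _ (wC_gt0 ww.1 s)) => c0.
  by rewrite (le_trans (g_le _)) // ler_wpM2l // wC_op.
have := abs_summable_prod ((in_l1P ww.1 a).1 al1) ((in_l1P ww.1 b).1 bl1).
apply: (abs_summable_dominated (k := c)) => -[s t] /=.
rewrite (mulrACA (a s)) [in leRHS]normrM.
rewrite (gtr0_norm (mulr_gt0 (wC_gt0 ww.1 s) (wC_gt0 ww.1 t))).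
exact: ler_normM_dominated (g_op_le s t).
Qed.

Lemma pairing_conv (g : S -> C) : weight_bounded w g ->
  pairing g (Defs.conv op a b) =
  usum (fun p : S * S => a p.1 * b p.2 * g (op p.1 p.2)).
Proof.
move=> gw.
rewrite -(usum_fibres (fun p => op p.1 p.2) (abs_summable_pairing_op gw)).
apply: eq_usum => u; rewrite mulrC mulr_usumr.
  by apply: eq_usum => p; case: eqP => [->|_]; rewrite ?mulr0 // mulrC.
apply: abs_summable_cvg.
have := abs_summable_pairing_op (weight_bounded_delta ww.1 u).
apply: (abs_summable_dominated (k := 1)) => p.
by rewrite mul1r; case: eqP; rewrite ?mulr1 ?normr0.
Qed.

End Convolution.

Lemma bdd_character_pairing (g : S -> C) : weight_bounded w g ->
  (forall s t, g (op s t) = g s * g t) ->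
  bdd_character (in_l1 w) (l1norm w) (Defs.conv op) (pairing g).
Proof.
move=> gw gM; split=> [|a b al1 bl1]; first exact: (bdd_form_pairing ww.1 gw).
rewrite pairing_conv // -(usum_prod_pairing ww.1 gw gw al1 bl1).
by apply: eq_usum => p; rewrite gM.
Qed.

Lemma point_derivation_pairing (g h d : S -> C) : weight_bounded w g ->
  weight_bounded w h -> weight_bounded w d ->
  (forall s t, d (op s t) = g s * d t + d s * h t) ->
  point_derivation (in_l1 w) (l1norm w) (Defs.conv op)
    (pairing g) (pairing h) (pairing d).
Proof.
move=> gw hw dw dM; split=> [|a b al1 bl1].
  exact: (bdd_form_pairing ww.1 dw).
rewrite pairing_conv // -(usum_prod_pairing ww.1 gw dw al1 bl1).
rewrite -(usum_prod_pairing ww.1 dw hw al1 bl1) -usumD.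
- by apply: eq_usum => p; rewrite dM mulrDr.
- exact: (abs_summable_cvg (abs_summable_prod_pairing ww.1 gw dw al1 bl1)).
exact: (abs_summable_cvg (abs_summable_prod_pairing ww.1 dw hw al1 bl1)).
Qed.

Lemma beurling_amenable_point_derivation (g h d : S -> C) :
  weight_bounded w g -> weight_bounded w h -> weight_bounded w d ->
  (forall s t, g (op s t) = g s * g t) ->
  (forall s t, h (op s t) = h s * h t) ->
  (forall s t, d (op s t) = g s * d t + d s * h t) ->
  beurling_amenable op w -> exists c : C, forall s, d s = c * (g s - h s).
Proof.
move=> gw hw dw gM hM dM amen.
have [c dE] := amenable_point_derivation (bdd_character_pairing gw gM)
  (bdd_character_pairing hw hM) amen (point_derivation_pairing gw hw dw dM).
exists c => s; rewrite -(pairing_delta d) dE ?pairing_delta //.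
by apply: (in_l1_single ww.1 (s0 := s)) => t /negPf ->.
Qed.

Lemma beurling_amenable_singleton s0 :
  (forall s : S, s = s0) -> beurling_amenable op w.
Proof.
move=> S1; pose e : S -> C := fun=> 1.
have in_l1T (a : S -> C) : in_l1 w a.
  by apply: (in_l1_single ww.1 (s0 := s0)) => s; rewrite (S1 s) eqxx.
apply: (@amenable_idempotent_line _ _ _ _ _ e) => // [|a _].
- apply/funext => u; rewrite /Defs.conv (@usum_single _ _ _ _ (s0, s0)) /=.
    by rewrite (S1 (op s0 s0)) (S1 u) eqxx mulr1.
  by move=> [s t]; rewrite (S1 s) (S1 t) eqxx.
by exists (a s0); apply/funext => s; rewrite (S1 s) -[LHS]mulr1.
Qed.

Section Idempotent.
Hypothesis opI : forall s, op s s = s.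

Lemma weight_ge1 s : 1 <= w s.
Proof. by have := ww.2 s s; rewrite opI (ler_pMr _ (ww.1 s)). Qed.

Lemma weight_bounded_le1 (g : S -> C) :
  (forall s, `|g s| <= 1) -> weight_bounded w g.
Proof.
move=> g1; exists 1 => s; rewrite mul1r (le_trans (g1 s)) //.
by rewrite /wC lecR weight_ge1.
Qed.

Lemma weight_bounded_bool (P : pred S) : weight_bounded w (fun s => (P s)%:R).
Proof.
by apply: weight_bounded_le1 => s; case: (P s); rewrite ?normr1 ?normr0.
Qed.

Lemma beurling_amenable_invariant (b : bool) (T : eqType) (f : S -> T) :
  (forall s t, f (op s t) = if b then f s else f t) ->
  beurling_amenable op w -> forall s t, f s = f t.
Proof.
move=> f_inv amen s t.
have [|||c fE] := beurling_amenable_point_derivation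
  (weight_bounded_bool (fun=> ~~ b)) (weight_bounded_bool (fun=> b))
  (weight_bounded_bool (fun u => f u == f t)) _ _ _ amen.
- by move=> u v; case: b {f_inv}; rewrite ?mulr0 ?mulr1.
- by move=> u v; case: b {f_inv}; rewrite ?mulr0 ?mulr1.
- by move=> u v; rewrite f_inv; case: b {f_inv};
    rewrite !(mulr0, mulr1, mul0r, mul1r, addr0, add0r).
have := fE s; rewrite -(fE t) eqxx.
by case: eqP => // _ /eqP; rewrite eq_sym oner_eq0.
Qed.

End Idempotent.
End BeurlingAlgebra.

Lemma rectangular_band_mid (S : Type) (op : S -> S -> S) :
  rectangular_band op -> forall s t u, op (op s t) u = op s u.
Proof.
move=> [opA _ opK] s t u.
by rewrite -[u in LHS](opK u s) !opA -(opA s t u) opK.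
Qed.

Theorem theorem2p4 (R : realType) (S : choiceType) (op : S -> S -> S)
    (w : S -> R) :
  rectangular_band op -> is_weight op w -> (exists s : S, True) ->
  (beurling_amenable op w <-> exists s0 : S, forall s : S, s = s0).
Proof.
move=> band ww [p _]; have [opA opI opK] := band.
have mid := rectangular_band_mid band.
split=> [amen|[s0 S1]]; last exact: (beurling_amenable_singleton ww S1).
exists p => q.
have invariant := beurling_amenable_invariant ww opI.
have qp : op q p = p.
  by rewrite -[RHS]opI; apply: (invariant true _ (op^~ p)).
have pq : op p q = p.
  rewrite -[RHS]opI; apply: (invariant false _ (op p)) => // s t.
  by rewrite opA mid.
by rewrite -(opK q p) qp.
Qed.
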